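(* Let $K$ be a field with $\mathrm{char}(K)\neq 2$ and let $\mathfrak{g}$ be a free non-abelian Lie algebra over $K$. Then the Lie algebra $L(\mathfrak{g})$ does not admit a finite presentation.
   Context: For a Lie algebra $\mathfrak{g}$ over $K$, let $\mathfrak{g}^{\psi}$ be an isomorphic copy of $\mathfrak{g}$ via $x\mapsto x^{\psi}$, and let $\chi(\mathfrak{g})=\langle \mathfrak{g},\mathfrak{g}^{\psi} \mid [x,x^{\psi}]=0 \text{ for all } x\in\mathfrak{g}\rangle$ (the quotient of the free product of the Lie algebras $\mathfrak{g}$ and $\mathfrak{g}^{\psi}$ by the ideal generated by all $[x,x^{\psi}]$). Let $\alpha:\chi(\mathfrak{g})\to\mathfrak{g}$ be the homomorphism with $\alpha(x)=\alpha(x^{\psi})=x$ for all $x\in\mathfrak{g}$, and $L(\mathfrak{g})=\ker(\alpha)$. A finite presentation is one, as a Lie algebra over $K$, with finitely many generators and finitely many relators. *)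

(* Defs.v *)
From HB Require Import structures.
From mathcomp Require Import all_boot all_algebra.
From mathcomp Require Import boolp.

Set Implicit Arguments.
Unset Strict Implicit.
Unset Printing Implicit Defensive.

Import GRing.Theory.
Local Open Scope ring_scope.
Local Open Scope quotient_scope.

Reserved Notation "[ 'lie' x , y ]" (format "[ 'lie'  x ,  y ]").
Reserved Notation "{ 'lie' g -> h }"
  (g at level 98, h at level 99, format "{ 'lie'  g  ->  h }").

HB.mixin Record isLieAlgebra (K : fieldType) g of GRing.Lmodule K g := {
  lie_bracket : g -> g -> g;
  lie_linearl : forall a x y z,
    lie_bracket (a *: x + y) z = a *: lie_bracket x z + lie_bracket y z;
  lie_linearr : forall a x y z,
    lie_bracket z (a *: x + y) = a *: lie_bracket z x + lie_bracket z y;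
  lie_alternating : forall x, lie_bracket x x = 0;
  lie_jacobi : forall x y z,
    lie_bracket x (lie_bracket y z) + lie_bracket y (lie_bracket z x)
      + lie_bracket z (lie_bracket x y) = 0
}.

#[short(type="lieAlgType")]
HB.structure Definition LieAlgebra (K : fieldType) :=
  {g of isLieAlgebra K g & GRing.Lmodule K g}.

Notation "[ 'lie' x , y ]" := (lie_bracket x y) : ring_scope.

HB.mixin Record isLieMorphism (K : fieldType) (g h : lieAlgType K)
    (f : g -> h) := {
  lie_morphB : {morph f : x y / [lie x, y]}
}.

#[short(type="lieHomType")]
HB.structure Definition LieMorphism (K : fieldType) (g h : lieAlgType K) :=
  {f of isLieMorphism K g h f & @GRing.Linear K g h *:%R f}.

Notation "{ 'lie' g -> h }" := (LieMorphism.type g h) : type_scope.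

Definition lie_iso (K : fieldType) (g h : lieAlgType K) : Prop :=
  exists f : {lie g -> h}, bijective f.

Definition lie_abelian (K : fieldType) (g : lieAlgType K) : Prop :=
  forall x y : g, [lie x, y] = 0.

Section LieTheory.
Variables (K : fieldType) (g : lieAlgType K).
Implicit Types x y z : g.

Lemma lie_addl x y z : [lie x + y, z] = [lie x, z] + [lie y, z].
Proof. by have := lie_linearl 1 x y z; rewrite !scale1r. Qed.

Lemma lie_addr x y z : [lie z, x + y] = [lie z, x] + [lie z, y].
Proof. by have := lie_linearr 1 x y z; rewrite !scale1r. Qed.

Lemma lie_0l z : [lie 0, z] = 0.
Proof. by apply: (addrI [lie 0, z]); rewrite -lie_addl !addr0. Qed.

Lemma lie_0r z : [lie z, 0] = 0.
Proof. by apply: (addrI [lie z, 0]); rewrite -lie_addr !addr0. Qed.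

Lemma lie_scalel a x z : [lie a *: x, z] = a *: [lie x, z].
Proof. by have := lie_linearl a x 0 z; rewrite lie_0l !addr0. Qed.

Lemma lie_scaler a x z : [lie z, a *: x] = a *: [lie z, x].
Proof. by have := lie_linearr a x 0 z; rewrite lie_0r !addr0. Qed.

Lemma lie_oppl x z : [lie - x, z] = - [lie x, z].
Proof. by rewrite -!scaleN1r lie_scalel. Qed.

Lemma lie_oppr x z : [lie z, - x] = - [lie z, x].
Proof. by rewrite -!scaleN1r lie_scaler. Qed.

Lemma lie_anti x y : [lie x, y] = - [lie y, x].
Proof.
apply/eqP; rewrite -addr_eq0; apply/eqP.
have := lie_alternating (x + y).
by rewrite lie_addl !lie_addr !lie_alternating add0r addr0.
Qed.

End LieTheory.

Inductive lie_term (K : fieldType) (X : Type) : Type :=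
| LVar of X
| LZero
| LAdd of lie_term K X & lie_term K X
| LScale of K & lie_term K X
| LBracket of lie_term K X & lie_term K X.
Arguments LVar {K X}.
Arguments LZero {K X}.

Section FreeLie.
Variables (K : fieldType) (X : Type).
Local Notation term := (lie_term K X).

HB.instance Definition _ := gen_eqMixin term.
HB.instance Definition _ := gen_choiceMixin term.

Inductive lie_term_eq : term -> term -> Prop :=
| lteq_refl t : lie_term_eq t t
| lteq_sym s t : lie_term_eq s t -> lie_term_eq t s
| lteq_trans s t u : lie_term_eq s t -> lie_term_eq t u -> lie_term_eq s u
| lteq_add s s' t t' : lie_term_eq s s' -> lie_term_eq t t' ->
    lie_term_eq (LAdd s t) (LAdd s' t')
| lteq_scale a t t' : lie_term_eq t t' ->
    lie_term_eq (LScale a t) (LScale a t')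
| lteq_bracket s s' t t' : lie_term_eq s s' -> lie_term_eq t t' ->
    lie_term_eq (LBracket s t) (LBracket s' t')
| lteq_addA s t u : lie_term_eq (LAdd s (LAdd t u)) (LAdd (LAdd s t) u)
| lteq_addC s t : lie_term_eq (LAdd s t) (LAdd t s)
| lteq_add0 t : lie_term_eq (LAdd LZero t) t
| lteq_addN t : lie_term_eq (LAdd (LScale (-1) t) t) LZero
| lteq_scaleA a b t : lie_term_eq (LScale a (LScale b t)) (LScale (a * b) t)
| lteq_scale1 t : lie_term_eq (LScale 1 t) t
| lteq_scaleDr a s t :
    lie_term_eq (LScale a (LAdd s t)) (LAdd (LScale a s) (LScale a t))
| lteq_scaleDl a b t :
    lie_term_eq (LScale (a + b) t) (LAdd (LScale a t) (LScale b t))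
| lteq_linearl a s t u : lie_term_eq (LBracket (LAdd (LScale a s) t) u)
    (LAdd (LScale a (LBracket s u)) (LBracket t u))
| lteq_linearr a s t u : lie_term_eq (LBracket u (LAdd (LScale a s) t))
    (LAdd (LScale a (LBracket u s)) (LBracket u t))
| lteq_alternating t : lie_term_eq (LBracket t t) LZero
| lteq_jacobi s t u : lie_term_eq
    (LAdd (LAdd (LBracket s (LBracket t u)) (LBracket t (LBracket u s)))
      (LBracket u (LBracket s t))) LZero.

Definition lie_term_eqb (s t : term) : bool := `[< lie_term_eq s t >].

Lemma lie_term_eqb_equiv : equiv_class_of lie_term_eqb.
Proof.
split=> [t|s t|t s u].
- by apply/asboolP; exact: lteq_refl.
- by apply/asboolP/asboolP; exact: lteq_sym.
- by move=> /asboolP st /asboolP tu; apply/asboolP; exact: lteq_trans st tu.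
Qed.
Canonical lie_term_equiv := EquivRelPack lie_term_eqb_equiv.

Definition freeLie : Type := {eq_quot lie_term_equiv}.
HB.instance Definition _ := Choice.on freeLie.
HB.instance Definition _ := EqQuotient.on freeLie.
Implicit Types x y z : freeLie.

Lemma free_piP (s t : term) :
  \pi_freeLie s = \pi_freeLie t <-> lie_term_eq s t.
Proof.
have piE : (\pi_freeLie s == \pi_freeLie t) = `[< lie_term_eq s t >].
  exact: (eqmodE lie_term_equiv s t).
split=> [/eqP|st]; first by rewrite piE => /asboolP.
by apply/eqP; rewrite piE; apply/asboolP.
Qed.

Lemma free_repr_pi (t : term) : lie_term_eq (repr (\pi_freeLie t)) t.
Proof. by apply/free_piP; rewrite reprK. Qed.

Definition free_gen (i : X) : freeLie := \pi_freeLie (LVar i).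
Definition free_zero : freeLie := \pi_freeLie LZero.
Definition free_add x y : freeLie := \pi_freeLie (LAdd (repr x) (repr y)).
Definition free_scale a x : freeLie := \pi_freeLie (LScale a (repr x)).
Definition free_opp x : freeLie := free_scale (-1) x.
Definition free_bracket x y : freeLie :=
  \pi_freeLie (LBracket (repr x) (repr y)).

Lemma free_addE s t :
  free_add (\pi_freeLie s) (\pi_freeLie t) = \pi_freeLie (LAdd s t).
Proof. by apply/free_piP; apply: lteq_add; exact: free_repr_pi. Qed.

Lemma free_scaleE a t :
  free_scale a (\pi_freeLie t) = \pi_freeLie (LScale a t).
Proof. by apply/free_piP; apply: lteq_scale; exact: free_repr_pi. Qed.

Lemma free_bracketE s t :
  free_bracket (\pi_freeLie s) (\pi_freeLie t)
    = \pi_freeLie (LBracket s t).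
Proof. by apply/free_piP; apply: lteq_bracket; exact: free_repr_pi. Qed.

Lemma free_ind (P : freeLie -> Prop) :
  (forall t, P (\pi_freeLie t)) -> forall x, P x.
Proof. exact: quotW. Qed.

Lemma free_addA : associative free_add.
Proof.
elim/free_ind=> s; elim/free_ind=> t; elim/free_ind=> u.
rewrite (free_addE t u) (free_addE s t) !free_addE.
by apply/free_piP; exact: lteq_addA.
Qed.

Lemma free_addC : commutative free_add.
Proof.
elim/free_ind=> s; elim/free_ind=> t; rewrite !free_addE.
by apply/free_piP; exact: lteq_addC.
Qed.

Lemma free_add0 : left_id free_zero free_add.
Proof.
elim/free_ind=> t; rewrite /free_zero free_addE.
by apply/free_piP; exact: lteq_add0.
Qed.

Lemma free_addN : left_inverse free_zero free_opp free_add.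
Proof.
elim/free_ind=> t; rewrite /free_opp free_scaleE free_addE.
by apply/free_piP; exact: lteq_addN.
Qed.

HB.instance Definition _ :=
  GRing.isZmodule.Build freeLie free_addA free_addC free_add0 free_addN.

Lemma free_scaleA a b x : free_scale a (free_scale b x) = free_scale (a * b) x.
Proof.
elim/free_ind: x => t; rewrite (free_scaleE b t) !free_scaleE.
by apply/free_piP; exact: lteq_scaleA.
Qed.

Lemma free_scale1 : left_id 1 free_scale.
Proof.
elim/free_ind=> t; rewrite free_scaleE.
by apply/free_piP; exact: lteq_scale1.
Qed.

Lemma free_scaleDr : right_distributive free_scale +%R.
Proof.
move=> a; elim/free_ind=> s; elim/free_ind=> t.
rewrite -![GRing.add _ _]/(free_add _ _).
rewrite (free_addE s t) (free_scaleE a s) (free_scaleE a t).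
rewrite free_scaleE free_addE.
by apply/free_piP; exact: lteq_scaleDr.
Qed.

Lemma free_scaleDl x : {morph free_scale^~ x : a b / a + b}.
Proof.
move=> a b; elim/free_ind: x => t; rewrite -[RHS]/(free_add _ _).
rewrite (free_scaleE a t) (free_scaleE b t) free_scaleE free_addE.
by apply/free_piP; exact: lteq_scaleDl.
Qed.

HB.instance Definition _ := GRing.Zmodule_isLmodule.Build K freeLie
  free_scaleA free_scale1 free_scaleDr free_scaleDl.

Lemma free_piD s t : \pi_freeLie (LAdd s t) = \pi_freeLie s + \pi_freeLie t.
Proof. by rewrite -free_addE. Qed.

Lemma free_piZ a t : \pi_freeLie (LScale a t) = a *: \pi_freeLie t.
Proof. by rewrite -free_scaleE. Qed.

Lemma free_linearl a x y z : free_bracket (a *: x + y) z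
  = a *: free_bracket x z + free_bracket y z.
Proof.
elim/free_ind: x => s; elim/free_ind: y => t; elim/free_ind: z => u.
rewrite (free_bracketE s u) (free_bracketE t u).
rewrite -!free_piZ -!free_piD free_bracketE.
by apply/free_piP; exact: lteq_linearl.
Qed.

Lemma free_linearr a x y z : free_bracket z (a *: x + y)
  = a *: free_bracket z x + free_bracket z y.
Proof.
elim/free_ind: x => s; elim/free_ind: y => t; elim/free_ind: z => u.
rewrite (free_bracketE u s) (free_bracketE u t).
rewrite -!free_piZ -!free_piD free_bracketE.
by apply/free_piP; exact: lteq_linearr.
Qed.

Lemma free_alternating x : free_bracket x x = 0.
Proof.
elim/free_ind: x => t; rewrite free_bracketE.
by apply/free_piP; exact: lteq_alternating.
Qed.

Lemma free_jacobi x y z :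
  free_bracket x (free_bracket y z) + free_bracket y (free_bracket z x)
    + free_bracket z (free_bracket x y) = 0.
Proof.
elim/free_ind: x => s; elim/free_ind: y => t; elim/free_ind: z => u.
rewrite (free_bracketE t u) (free_bracketE u s) (free_bracketE s t).
rewrite !free_bracketE -!free_piD.
by apply/free_piP; exact: lteq_jacobi.
Qed.

HB.instance Definition _ := isLieAlgebra.Build K freeLie
  free_linearl free_linearr free_alternating free_jacobi.

Lemma free_piB s t :
  \pi_freeLie (LBracket s t) = [lie \pi_freeLie s, \pi_freeLie t].
Proof. by rewrite -free_bracketE. Qed.

Section UniversalProperty.
Variables (h : lieAlgType K) (f : X -> h).

Fixpoint lie_term_eval (t : term) : h :=
  match t with
  | LVar i => f i
  | LZero => 0
  | LAdd s t => lie_term_eval s + lie_term_eval t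
  | LScale a t => a *: lie_term_eval t
  | LBracket s t => [lie lie_term_eval s, lie_term_eval t]
  end.

Lemma lie_term_eval_eq s t :
  lie_term_eq s t -> lie_term_eval s = lie_term_eval t.
Proof.
elim=> {s t} //=.
- by move=> s t u _ -> _ ->.
- by move=> s s' t t' _ -> _ ->.
- by move=> a t t' _ ->.
- by move=> s s' t t' _ -> _ ->.
- by move=> s t u; rewrite addrA.
- by move=> s t; rewrite addrC.
- by move=> t; rewrite add0r.
- by move=> t; rewrite scaleN1r addNr.
- by move=> a b t; rewrite scalerA.
- by move=> t; rewrite scale1r.
- by move=> a s t; rewrite scalerDr.
- by move=> a b t; rewrite scalerDl.
- by move=> a s t u; rewrite lie_linearl.
- by move=> a s t u; rewrite lie_linearr.
- by move=> t; rewrite lie_alternating.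
- by move=> s t u; rewrite lie_jacobi.
Qed.

Definition free_lift x : h := lie_term_eval (repr x).

Lemma free_liftE t : free_lift (\pi_freeLie t) = lie_term_eval t.
Proof. by apply: lie_term_eval_eq; exact: free_repr_pi. Qed.

Lemma free_lift_linear : linear free_lift.
Proof.
move=> a x y; rewrite -[x]reprK -[y]reprK -free_piZ -free_piD.
by rewrite !free_liftE.
Qed.
HB.instance Definition _ :=
  GRing.isLinear.Build K freeLie h *:%R free_lift free_lift_linear.

Lemma free_lift_morphB : {morph free_lift : x y / [lie x, y]}.
Proof.
by move=> x y; rewrite -[x]reprK -[y]reprK -free_piB !free_liftE.
Qed.
HB.instance Definition _ :=
  isLieMorphism.Build K freeLie h free_lift free_lift_morphB.

Lemma free_lift_gen i : free_lift (free_gen i) = f i.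
Proof. exact: free_liftE. Qed.

Lemma free_lift_unique (phi : {lie freeLie -> h}) :
  (forall i, phi (free_gen i) = f i) -> phi =1 free_lift.
Proof.
move=> phi_gen x; rewrite -[x]reprK free_liftE.
elim: (repr x) => /= [i||s IHs t IHt|a t IHt|s IHs t IHt].
- exact: phi_gen.
- exact: (raddf0 phi).
- by rewrite free_piD raddfD /= IHs IHt.
- by rewrite free_piZ linearZ /= IHt.
- by rewrite free_piB lie_morphB /= IHs IHt.
Qed.

End UniversalProperty.
End FreeLie.

Definition is_free_lie (K : fieldType) (g : lieAlgType K) : Prop :=
  exists X : Type, lie_iso (freeLie K X) g.

Definition is_lie_ideal (K : fieldType) (g : lieAlgType K) (I : g -> Prop) :=
  [/\ I 0, forall a x y, I x -> I y -> I (a *: x + y)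
    & forall x y, I y -> I [lie x, y]].

Section Quotient.
Variables (K : fieldType) (g : lieAlgType K) (S : g -> Prop).
Implicit Types x y z : g.

Definition gen_ideal x : Prop :=
  forall I : g -> Prop, is_lie_ideal I -> (forall s, S s -> I s) -> I x.

Lemma gen_ideal_sub s : S s -> gen_ideal s.
Proof. by move=> Ss I _; apply. Qed.

Lemma gen_ideal_is_ideal : is_lie_ideal gen_ideal.
Proof.
split=> [I [I0]|a x y Ix Iy I idI SI|x y Iy I idI SI] //.
- by case: (idI) => _ + _; apply; [exact: Ix | exact: Iy].
- by case: (idI) => _ _; apply; exact: Iy.
Qed.

Definition gen_ideal_pred : {pred g} := [pred x | `[< gen_ideal x >]].

Lemma gen_idealP x : reflect (gen_ideal x) (x \in gen_ideal_pred).
Proof. exact: asboolP. Qed.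

Lemma gen_ideal_zmod_closed : zmod_closed gen_ideal_pred.
Proof.
case: gen_ideal_is_ideal => I0 Ilin _.
split=> [|x y /gen_idealP Ix /gen_idealP Iy]; apply/gen_idealP => //.
by rewrite addrC -scaleN1r; exact: Ilin.
Qed.
HB.instance Definition _ :=
  GRing.isZmodClosed.Build g gen_ideal_pred gen_ideal_zmod_closed.

Lemma gen_idealZ a x : x \in gen_ideal_pred -> a *: x \in gen_ideal_pred.
Proof.
case: gen_ideal_is_ideal => I0 Ilin _ /gen_idealP Ix; apply/gen_idealP.
by rewrite -[_ *: _]addr0; exact: Ilin.
Qed.

Lemma gen_idealBr x y : y \in gen_ideal_pred -> [lie x, y] \in gen_ideal_pred.
Proof.
case: gen_ideal_is_ideal => _ _ Ibr /gen_idealP Iy; apply/gen_idealP.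
exact: Ibr.
Qed.

Lemma gen_idealBl x y : x \in gen_ideal_pred -> [lie x, y] \in gen_ideal_pred.
Proof. by move=> Ix; rewrite lie_anti rpredN gen_idealBr. Qed.

Definition quotLie : Type := Quotient.quot gen_ideal_pred.
HB.instance Definition _ := GRing.Zmodule.on quotLie.
HB.instance Definition _ := Quotient.on quotLie.

Definition quot_proj (x : g) : quotLie := \pi_quotLie x.

Lemma quot_projP x y : quot_proj x = quot_proj y <-> gen_ideal (x - y).
Proof.
rewrite /quot_proj; split=> [/eqP|].
- by rewrite -Quotient.idealrBE => /gen_idealP.
- by move/gen_idealP => xy; apply/eqP; rewrite -Quotient.idealrBE.
Qed.

Lemma quot_proj_repr (q : quotLie) : quot_proj (repr q) = q.
Proof. exact: reprK. Qed.

Lemma quot_repr_proj x : repr (quot_proj x) - x \in gen_ideal_pred.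
Proof. by apply/gen_idealP/quot_projP; rewrite quot_proj_repr. Qed.

Lemma quot_proj_eq x y : x - y \in gen_ideal_pred -> quot_proj x = quot_proj y.
Proof. by move/gen_idealP/quot_projP. Qed.

Lemma quot_projD : {morph quot_proj : x y / x + y}.
Proof. by move=> x y; exact: (raddfD \pi_(Quotient.quot gen_ideal_pred)). Qed.

Definition quot_scale a (q : quotLie) : quotLie := quot_proj (a *: repr q).
Definition quot_bracket (p q : quotLie) : quotLie :=
  quot_proj [lie repr p, repr q].

Lemma quot_scaleE a x : quot_scale a (quot_proj x) = quot_proj (a *: x).
Proof.
by apply: quot_proj_eq; rewrite -scalerBr gen_idealZ ?quot_repr_proj.
Qed.

Lemma quot_bracketE x y :
  quot_bracket (quot_proj x) (quot_proj y) = quot_proj [lie x, y].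
Proof.
apply: quot_proj_eq; set x' := repr _; set y' := repr _.
have -> : [lie x', y'] - [lie x, y] = [lie x' - x, y'] + [lie x, y' - y].
  by rewrite lie_addl lie_addr lie_oppl lie_oppr addrA addrNK.
apply: rpredD.
- by apply: gen_idealBl; exact: quot_repr_proj.
- by apply: gen_idealBr; exact: quot_repr_proj.
Qed.

Lemma quot_scaleA a b q : quot_scale a (quot_scale b q) = quot_scale (a * b) q.
Proof. by rewrite -[q]quot_proj_repr !quot_scaleE scalerA. Qed.

Lemma quot_scale1 : left_id 1 quot_scale.
Proof. by move=> q; rewrite -[q]quot_proj_repr quot_scaleE scale1r. Qed.

Lemma quot_scaleDr : right_distributive quot_scale +%R.
Proof.
move=> a p q; rewrite -[p]quot_proj_repr -[q]quot_proj_repr.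
by rewrite -quot_projD !quot_scaleE -quot_projD scalerDr.
Qed.

Lemma quot_scaleDl q : {morph quot_scale^~ q : a b / a + b}.
Proof.
move=> a b; rewrite -[q]quot_proj_repr !quot_scaleE -quot_projD.
by rewrite scalerDl.
Qed.

HB.instance Definition _ := GRing.Zmodule_isLmodule.Build K quotLie
  quot_scaleA quot_scale1 quot_scaleDr quot_scaleDl.

Lemma quot_proj_linear : linear quot_proj.
Proof. by move=> a x y; rewrite quot_projD -quot_scaleE. Qed.
HB.instance Definition _ :=
  GRing.isLinear.Build K g quotLie *:%R quot_proj quot_proj_linear.

Lemma quot_linearl a p q r : quot_bracket (a *: p + q) r
  = a *: quot_bracket p r + quot_bracket q r.
Proof.
rewrite -[p]quot_proj_repr -[q]quot_proj_repr -[r]quot_proj_repr.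
by rewrite -linearP !quot_bracketE -linearP lie_linearl.
Qed.

Lemma quot_linearr a p q r : quot_bracket r (a *: p + q)
  = a *: quot_bracket r p + quot_bracket r q.
Proof.
rewrite -[p]quot_proj_repr -[q]quot_proj_repr -[r]quot_proj_repr.
by rewrite -linearP !quot_bracketE -linearP lie_linearr.
Qed.

Lemma quot_alternating q : quot_bracket q q = 0.
Proof.
by rewrite -[q]quot_proj_repr quot_bracketE lie_alternating raddf0.
Qed.

Lemma quot_jacobi p q r :
  quot_bracket p (quot_bracket q r) + quot_bracket q (quot_bracket r p)
    + quot_bracket r (quot_bracket p q) = 0.
Proof.
rewrite -[p]quot_proj_repr -[q]quot_proj_repr -[r]quot_proj_repr.
by rewrite !quot_bracketE -!raddfD lie_jacobi raddf0.
Qed.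

HB.instance Definition _ := isLieAlgebra.Build K quotLie
  quot_linearl quot_linearr quot_alternating quot_jacobi.

Lemma quot_proj_morphB : {morph quot_proj : x y / [lie x, y]}.
Proof. by move=> x y; rewrite -quot_bracketE. Qed.
HB.instance Definition _ :=
  isLieMorphism.Build K g quotLie quot_proj quot_proj_morphB.

Section UniversalProperty.
Variables (h : lieAlgType K) (f : {lie g -> h}).

Definition quot_lift of (forall s, S s -> f s = 0) :=
  fun q : quotLie => f (repr q).

Hypothesis f_S : forall s, S s -> f s = 0.

Lemma gen_ideal_ker x : gen_ideal x -> f x = 0.
Proof.
move=> /(_ (fun y => f y = 0)); apply=> //; split=> [|a y z fy fz|y z fz].
- exact: raddf0.
- by rewrite linearP /= fy fz scaler0 addr0.
- by rewrite lie_morphB fz lie_0r.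
Qed.

Lemma quot_lift_proj x : quot_lift f_S (quot_proj x) = f x.
Proof.
apply/eqP; rewrite -subr_eq0 -raddfB; apply/eqP.
by apply: gen_ideal_ker; apply/gen_idealP; exact: quot_repr_proj.
Qed.

Lemma quot_lift_linear : linear (quot_lift f_S).
Proof.
move=> a p q; rewrite -[p]quot_proj_repr -[q]quot_proj_repr -linearP.
by rewrite !quot_lift_proj linearP.
Qed.
HB.instance Definition _ :=
  GRing.isLinear.Build K quotLie h *:%R (quot_lift f_S) quot_lift_linear.

Lemma quot_lift_morphB : {morph quot_lift f_S : x y / [lie x, y]}.
Proof.
move=> p q; rewrite -[p]quot_proj_repr -[q]quot_proj_repr -lie_morphB.
by rewrite !quot_lift_proj lie_morphB.
Qed.
HB.instance Definition _ :=
  isLieMorphism.Build K quotLie h (quot_lift f_S) quot_lift_morphB.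

End UniversalProperty.
End Quotient.

Definition finitely_presented (K : fieldType) (g : lieAlgType K) : Prop :=
  exists (n : nat) (R : seq (freeLie K 'I_n)),
    lie_iso (quotLie (fun r => r \in R)) g.

Section FreeProduct.
Variables (K : fieldType) (g h : lieAlgType K).
Local Notation F := (freeLie K (g + h)).
Local Notation genl x := (free_gen K (inl x : g + h)).
Local Notation genr x := (free_gen K (inr x : g + h)).

(* The free Lie algebra on the disjoint union of the underlying sets, modulo
   the relations making both inclusions Lie algebra homomorphisms. *)
Inductive free_prod_rel : F -> Prop :=
| fprel_linearl a (x y : g) :
    free_prod_rel (genl (a *: x + y) - (a *: genl x + genl y))
| fprel_bracketl (x y : g) :
    free_prod_rel (genl [lie x, y] - [lie genl x, genl y])
| fprel_linearr a (x y : h) :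
    free_prod_rel (genr (a *: x + y) - (a *: genr x + genr y))
| fprel_bracketr (x y : h) :
    free_prod_rel (genr [lie x, y] - [lie genr x, genr y]).

Definition freeProd : Type := quotLie free_prod_rel.
HB.instance Definition _ := LieAlgebra.on freeProd.

Definition fprod_inl (x : g) : freeProd := quot_proj free_prod_rel (genl x).
Definition fprod_inr (x : h) : freeProd := quot_proj free_prod_rel (genr x).

Lemma fprod_inl_linear : linear fprod_inl.
Proof.
move=> a x y; rewrite -linearP.
apply: (iffRL (quot_projP _ _ _)); apply: gen_ideal_sub.
exact: fprel_linearl.
Qed.
HB.instance Definition _ :=
  GRing.isLinear.Build K g freeProd *:%R fprod_inl fprod_inl_linear.

Lemma fprod_inr_linear : linear fprod_inr.
Proof.
move=> a x y; rewrite -linearP.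
apply: (iffRL (quot_projP _ _ _)); apply: gen_ideal_sub.
exact: fprel_linearr.
Qed.
HB.instance Definition _ :=
  GRing.isLinear.Build K h freeProd *:%R fprod_inr fprod_inr_linear.

Lemma fprod_inl_morphB : {morph fprod_inl : x y / [lie x, y]}.
Proof.
move=> x y; rewrite -[RHS]lie_morphB.
apply: (iffRL (quot_projP _ _ _)); apply: gen_ideal_sub.
exact: fprel_bracketl.
Qed.
HB.instance Definition _ :=
  isLieMorphism.Build K g freeProd fprod_inl fprod_inl_morphB.

Lemma fprod_inr_morphB : {morph fprod_inr : x y / [lie x, y]}.
Proof.
move=> x y; rewrite -[RHS]lie_morphB.
apply: (iffRL (quot_projP _ _ _)); apply: gen_ideal_sub.
exact: fprel_bracketr.
Qed.
HB.instance Definition _ :=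
  isLieMorphism.Build K h freeProd fprod_inr fprod_inr_morphB.

Section UniversalProperty.
Variables (k : lieAlgType K) (f1 : {lie g -> k}) (f2 : {lie h -> k}).

Definition fprod_gen_map (u : g + h) : k :=
  match u with inl x => f1 x | inr x => f2 x end.

Lemma free_prod_rel_ker r :
  free_prod_rel r -> free_lift fprod_gen_map r = 0.
Proof.
case=> [a x y|x y|a x y|x y]; apply/eqP; rewrite raddfB subr_eq0.
- by rewrite /= linearP /= !free_lift_gen /= linearP.
- by rewrite /= lie_morphB /= !free_lift_gen /= lie_morphB.
- by rewrite /= linearP /= !free_lift_gen /= linearP.
- by rewrite /= lie_morphB /= !free_lift_gen /= lie_morphB.
Qed.

Definition fprod_lift : freeProd -> k :=
  quot_lift (f := free_lift fprod_gen_map) free_prod_rel_ker.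
HB.instance Definition _ := LieMorphism.on fprod_lift.

Lemma fprod_lift_inl x : fprod_lift (fprod_inl x) = f1 x.
Proof. by rewrite [LHS]quot_lift_proj /= free_lift_gen. Qed.

Lemma fprod_lift_inr x : fprod_lift (fprod_inr x) = f2 x.
Proof. by rewrite [LHS]quot_lift_proj /= free_lift_gen. Qed.

End UniversalProperty.
End FreeProduct.

Section Kernel.
Variables (K : fieldType) (g h : lieAlgType K) (f : {lie g -> h}).

Definition lie_ker_pred : {pred g} := [pred x | f x == 0].

Lemma lie_ker_submod_closed : submod_closed lie_ker_pred.
Proof.
split=> [|a x y]; rewrite !inE ?raddf0 // => /eqP fx /eqP fy.
by rewrite linearP /= fx fy scaler0 addr0.
Qed.
HB.instance Definition _ :=
  GRing.isSubmodClosed.Build K g lie_ker_pred lie_ker_submod_closed.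

Record lieKer : Type :=
  LieKer { lie_ker_val :> g; _ : lie_ker_val \in lie_ker_pred }.
HB.instance Definition _ := [isSub for lie_ker_val].
HB.instance Definition _ := [Choice of lieKer by <:].
HB.instance Definition _ := [SubChoice_isSubZmodule of lieKer by <:].
HB.instance Definition _ := [SubZmodule_isSubLmodule of lieKer by <:].

Lemma lie_ker_bracket_subproof (x y : lieKer) :
  [lie val x, val y] \in lie_ker_pred.
Proof.
by rewrite inE lie_morphB; move/eqP: (valP x) => ->; rewrite lie_0l.
Qed.
Definition lie_ker_bracket (x y : lieKer) : lieKer :=
  LieKer (lie_ker_bracket_subproof x y).

Lemma lie_ker_linearl a x y z : lie_ker_bracket (a *: x + y) z
  = a *: lie_ker_bracket x z + lie_ker_bracket y z.
Proof. by apply: val_inj => /=; rewrite lie_linearl. Qed.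

Lemma lie_ker_linearr a x y z : lie_ker_bracket z (a *: x + y)
  = a *: lie_ker_bracket z x + lie_ker_bracket z y.
Proof. by apply: val_inj => /=; rewrite lie_linearr. Qed.

Lemma lie_ker_alternating x : lie_ker_bracket x x = 0.
Proof. by apply: val_inj => /=; rewrite lie_alternating. Qed.

Lemma lie_ker_jacobi x y z :
  lie_ker_bracket x (lie_ker_bracket y z)
    + lie_ker_bracket y (lie_ker_bracket z x)
    + lie_ker_bracket z (lie_ker_bracket x y) = 0.
Proof. by apply: val_inj => /=; rewrite lie_jacobi. Qed.

HB.instance Definition _ := isLieAlgebra.Build K lieKer
  lie_ker_linearl lie_ker_linearr lie_ker_alternating lie_ker_jacobi.

End Kernel.

Section Chi.
Variables (K : fieldType) (g : lieAlgType K).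

(* The isomorphic copy [g^psi] is the second factor of the free product of [g]
   with itself, and [x^psi] is [fprod_inr g x]. *)
Inductive chi_rel : freeProd g g -> Prop :=
| ChiRel (x : g) : chi_rel [lie fprod_inl g x, fprod_inr g x].

Definition chi : Type := quotLie chi_rel.
HB.instance Definition _ := LieAlgebra.on chi.

Definition chi_inl (x : g) : chi := quot_proj chi_rel (fprod_inl g x).
Definition chi_inr (x : g) : chi := quot_proj chi_rel (fprod_inr g x).

Lemma lie_id_morphB : {morph (@idfun g) : x y / [lie x, y]}.
Proof. by []. Qed.
HB.instance Definition _ := isLieMorphism.Build K g g idfun lie_id_morphB.

Lemma chi_rel_ker r : chi_rel r -> fprod_lift (@idfun g) (@idfun g) r = 0.
Proof.
case=> x; rewrite lie_morphB /= fprod_lift_inl fprod_lift_inr.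
exact: lie_alternating.
Qed.

Definition chi_alpha : chi -> g :=
  quot_lift (f := fprod_lift (@idfun g) (@idfun g)) chi_rel_ker.
HB.instance Definition _ := LieMorphism.on chi_alpha.

Lemma chi_alpha_inl x : chi_alpha (chi_inl x) = x.
Proof. by rewrite [LHS]quot_lift_proj /= fprod_lift_inl. Qed.

Lemma chi_alpha_inr x : chi_alpha (chi_inr x) = x.
Proof. by rewrite [LHS]quot_lift_proj /= fprod_lift_inr. Qed.

Definition lieL : Type := lieKer chi_alpha.
HB.instance Definition _ := LieAlgebra.on lieL.

End Chi.

Arguments chi_alpha {K g}.
Arguments chi_inl {K g}.
Arguments chi_inr {K g}.

(* Main.v *)
Require Import Defs.
From HB Require Import structures.
From mathcomp Require Import all_boot all_algebra.
From mathcomp Require Import boolp.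
From mathcomp Require Import ring.

Set Implicit Arguments.
Unset Strict Implicit.
Unset Printing Implicit Defensive.

Import GRing.Theory.
Local Open Scope ring_scope.

(** Write [x'] for the copy of [x] in the second factor, [d x = x - x'] for the
    generators of [L = L(g)], and [y_k = ad(x)^k y], where [x] and [y] are two
    members of a basis of [g].

    A finitely presented Lie algebra has few central extensions. Let [omega] be
    a 2-cocycle on [L] with values in [K[X]]. It defines an extension of [L] by
    the central ideal [K[X]]; lifting to it the generators of a finite
    presentation sends the finitely many relators to polynomials of bounded
    degree. If [l] and [l'] commute in [L], the bracket of their lifts is
    [omega(l, l')], and it lies in the ideal generated by the relators. Hence
    [omega] takes values of bounded degree on commuting pairs
    ([fp_cocycle_bounded]). The proof exhibits a cocycle and commuting pairs
    that violate this.

    The cocycle. Killing one of the two factors gives two maps from [chi(g)] to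
    [g], and the free Lie algebra [g] maps to the semidirect product of an
    abelian ideal [K[X]] with [K[X]] acting on it by multiplication, by sending
    [x] to the operator [X] and [y] to the vector [1]. This gives a pair of
    module coordinates [p], [q] and, since [alpha] vanishes on [L], opposite
    operator coordinates [v], [-v]. So the product [K[X] x K[X] -> K[X]] is an
    invariant pairing, and [omega(l, l') = p(l) q(l') - p(l') q(l)] is a
    cocycle. The central extension is realised by the Lie algebra [heis].

    The commuting pairs. When 2 is invertible, [[d a, d b], d c] = d [[a, b], c]
    holds in [L] ([delta_triple]): [d] is a homomorphism of Lie triple systems.
    From this identity alone, [[d x, d y] + d [x, y]] commutes with
    [[d x, d y_m] - d y_(m+1)] ([commuting_elements]). The first element has
    coordinates [p = 2 X], [q = 0] and the second one [q = 2 X^(m+1)], so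
    [omega] takes the value [4 X^(m+2)] on this pair, for every [m]. *)

(** * Lie algebra preliminaries *)

Lemma lie_leibniz (K : fieldType) (g : lieAlgType K) (a b c : g) :
  [lie a, [lie b, c]] = [lie [lie a, b], c] + [lie b, [lie a, c]].
Proof.
rewrite (lie_anti [lie a, b] c) (lie_anti a c) lie_oppr -opprD.
by apply/eqP; rewrite -addr_eq0 [X in _ + X]addrC addrA lie_jacobi.
Qed.

Lemma double_eq0 (K : fieldType) (V : lmodType K) (charK : 2%N \notin [pchar K])
    (x : V) : x = - x -> x = 0.
Proof.
move=> /eqP; rewrite -addr_eq0 -mulr2n -scaler_nat scaler_eq0 => /orP[|/eqP//].
by rewrite inE /= in charK => two0; rewrite two0 in charK.
Qed.

(** * Homomorphisms of Lie triple systems *)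

Section TripleHom.
Variables (K : fieldType) (g h : lieAlgType K) (d : {linear g -> h}).
Hypothesis triple :
  forall a b c, [lie [lie d a, d b], d c] = d [lie [lie a, b], c].

(** The obstruction to extending [d [a, b] |-> [d a, d b]] to a Lie bracket: it
    vanishes as soon as [[d [a, b], d c] = [[d a, d b], d c]], by Jacobi. *)
Definition jacobiator (a b c : g) : h :=
  [lie d [lie a, b], d c] + [lie d [lie b, c], d a] + [lie d [lie c, a], d b].

Lemma jacobiator_swap a b c : jacobiator a b c = - jacobiator c b a.
Proof.
rewrite /jacobiator (lie_anti a b) (lie_anti b c) (lie_anti c a).
rewrite !(linearN d) !lie_oppl -!opprD; congr (- (_ + _)).
by rewrite addrC.
Qed.

(** Expand by letting [[d a, d b]] act as a derivation, which by the triple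
    identity is the action of [[a, b]] on [g]. *)
Lemma bracket_pairs a b c e :
  [lie [lie d a, d b], [lie d c, d e]]
  = jacobiator [lie a, b] c e + [lie d [lie a, b], d [lie c, e]].
Proof.
rewrite lie_leibniz !triple /jacobiator (lie_anti e [lie a, b]).
rewrite (linearN d) lie_oppl (lie_anti (d c)) -!addrA; congr (_ + _).
by rewrite (lie_anti (d [lie c, e])) addrCA addNr addr0.
Qed.

(** The left side of [bracket_pairs] and its last term both change sign when the
    pairs [(a, b)] and [(c, e)] are exchanged. *)
Lemma jacobiator_exchange a b c e :
  jacobiator [lie a, b] c e = - jacobiator [lie c, e] a b.
Proof.
apply: (addIr [lie d [lie a, b], d [lie c, e]]).
by rewrite -bracket_pairs lie_anti bracket_pairs opprD -lie_anti.
Qed.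

Variables x y : g.
Let ad_iter k := iter k (lie_bracket x) y.

(** One application of [ad x] can be moved from one end of the jacobiator to
    the other: combine [jacobiator_exchange] with [jacobiator_swap]. *)
Lemma jacobiator_iter i j :
  jacobiator (ad_iter i) x (ad_iter j) = jacobiator y x (ad_iter (i + j)).
Proof.
elim: i j => [//|i IH] j; rewrite addSnnS -IH /=.
by rewrite jacobiator_exchange -jacobiator_swap.
Qed.

Hypothesis charK : 2%N \notin [pchar K].

(** By [jacobiator_iter] the value depends only on [i + j], hence is symmetric
    in [i] and [j]; by [jacobiator_swap] it is antisymmetric. *)
Lemma jacobiator_iter0 i j : jacobiator (ad_iter i) x (ad_iter j) = 0.
Proof.
apply: (double_eq0 charK).
by rewrite {1}jacobiator_swap !jacobiator_iter addnC.
Qed.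

(** By [bracket_pairs] and the triple identity, all terms of the expansion
    cancel except the jacobiator of [[x, y]], [x] and [ad_iter m]. *)
Lemma commuting_elements m :
  [lie [lie d x, d y] + d [lie x, y],
       [lie d x, d (ad_iter m)] - d (ad_iter m.+1)] = 0.
Proof.
rewrite lie_addl !lie_addr !lie_oppr bracket_pairs.
have -> : jacobiator [lie x, y] x (ad_iter m) = 0
  by exact: (jacobiator_iter0 1).
rewrite add0r triple (lie_anti (d [lie x, y]) [lie d x, _]) triple.
rewrite (lie_anti [lie x, ad_iter m]) (linearN d) opprK.
by rewrite -[X in _ + X]opprB subrr.
Qed.

End TripleHom.

(** * A cocycle obstruction to finite presentability *)

Section Heis.
Variable K : fieldType.

(** Elements are tuples [(p, q, v, z)]. Here [v] acts on the two modules [p] and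
    [q] by multiplication with opposite signs; the signs make the product
    pairing of these modules invariant, so that it can be added as a bracket with
    values in the central coordinate [z]. *)
Definition heis : Type := ({poly K} * {poly K} * {poly K} * {poly K})%type.
HB.instance Definition _ := GRing.Lmodule.on heis.

Definition heis_p (u : heis) : {poly K} := u.1.1.1.
Definition heis_q (u : heis) : {poly K} := u.1.1.2.
Definition heis_v (u : heis) : {poly K} := u.1.2.
Definition heis_z (u : heis) : {poly K} := u.2.

Definition heis_bracket (u w : heis) : heis :=
  (heis_v u * heis_p w - heis_v w * heis_p u,
   heis_v w * heis_q u - heis_v u * heis_q w,
   0,
   heis_p u * heis_q w - heis_p w * heis_q u).

Arguments heis_p u : simpl never.
Arguments heis_q u : simpl never.
Arguments heis_v u : simpl never.
Arguments heis_z u : simpl never.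
Arguments heis_bracket u w : simpl never.

Lemma heis_p_linear : linear heis_p. Proof. by []. Qed.
Lemma heis_q_linear : linear heis_q. Proof. by []. Qed.
Lemma heis_v_linear : linear heis_v. Proof. by []. Qed.
Lemma heis_z_linear : linear heis_z. Proof. by []. Qed.
HB.instance Definition _ :=
  GRing.isLinear.Build K heis {poly K} *:%R heis_p heis_p_linear.
HB.instance Definition _ :=
  GRing.isLinear.Build K heis {poly K} *:%R heis_q heis_q_linear.
HB.instance Definition _ :=
  GRing.isLinear.Build K heis {poly K} *:%R heis_v heis_v_linear.
HB.instance Definition _ :=
  GRing.isLinear.Build K heis {poly K} *:%R heis_z heis_z_linear.

Lemma heis_ext u w : heis_p u = heis_p w -> heis_q u = heis_q w ->
  heis_v u = heis_v w -> heis_z u = heis_z w -> u = w.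
Proof.
case: u w => [[[p q] v] z] [[[p' q'] v'] z'].
by rewrite /heis_p /heis_q /heis_v /heis_z /= => -> -> -> ->.
Qed.

Lemma heis_bracketE u w :
  (heis_p (heis_bracket u w) = heis_v u * heis_p w - heis_v w * heis_p u) *
  (heis_q (heis_bracket u w) = heis_v w * heis_q u - heis_v u * heis_q w) *
  (heis_v (heis_bracket u w) = 0) *
  (heis_z (heis_bracket u w) = heis_p u * heis_q w - heis_p w * heis_q u).
Proof. by split. Qed.

Lemma heis_linearl a (u w t : heis) :
  heis_bracket (a *: u + w) t = a *: heis_bracket u t + heis_bracket w t.
Proof.
apply: heis_ext;
  rewrite linearP /= !heis_bracketE ?linearP /= -?mul_polyC; ring.
Qed.

Lemma heis_linearr a (u w t : heis) :
  heis_bracket t (a *: u + w) = a *: heis_bracket t u + heis_bracket t w.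
Proof.
apply: heis_ext;
  rewrite linearP /= !heis_bracketE ?linearP /= -?mul_polyC; ring.
Qed.

Lemma heis_alternating u : heis_bracket u u = 0.
Proof. by rewrite /heis_bracket !subrr. Qed.

Lemma heis_jacobi u w t :
  heis_bracket u (heis_bracket w t) + heis_bracket w (heis_bracket t u)
    + heis_bracket t (heis_bracket u w) = 0.
Proof.
apply: heis_ext; rewrite !linearD linear0 /= !heis_bracketE; ring.
Qed.

HB.instance Definition _ := isLieAlgebra.Build K heis
  heis_linearl heis_linearr heis_alternating heis_jacobi.

(** The central ideal to which the relators of a finite presentation are sent.
*)
Definition heis_bounded m (u : heis) : Prop :=
  [/\ heis_p u = 0, heis_q u = 0, heis_v u = 0 & (size (heis_z u) <= m)%N].

Lemma heis_bounded_ideal m : is_lie_ideal (heis_bounded m).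
Proof.
split=> [|a u w [pu qu vu zu] [pw qw vw zw]|u w [pw qw vw zw]].
- by rewrite /heis_bounded /heis_z size_poly0.
- rewrite /heis_bounded /heis_p /heis_q /heis_v /heis_z /=.
  rewrite -!/(heis_p _) -!/(heis_q _) -!/(heis_v _) -!/(heis_z _).
  rewrite pu qu vu pw qw vw !scaler0 !addr0; split=> //.
  apply: (leq_trans (size_polyD _ _)); rewrite geq_max zw andbT.
  exact: leq_trans (size_scale_leq _ _) zu.
- rewrite /heis_bounded {1}/heis_p {1}/heis_q {1}/heis_v {1}/heis_z /=.
  by rewrite pw qw vw !mulr0 !mul0r !subrr size_poly0.
Qed.

End Heis.

Lemma freeLie_ind (K : fieldType) (X : Type) (P : freeLie K X -> Prop) :
  (forall i, P (free_gen K i)) -> P 0 ->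
  (forall u w, P u -> P w -> P (u + w)) ->
  (forall a u, P u -> P (a *: u)) ->
  (forall u w, P u -> P w -> P [lie u, w]) -> forall u, P u.
Proof.
move=> Pg P0 PD PZ PB; elim/free_ind.
elim=> [i||s Ps t Pt|a t Pt|s Ps t Pt].
- exact: Pg.
- exact: P0.
- by rewrite free_piD; apply: PD.
- by rewrite free_piZ; apply: PZ.
- by rewrite free_piB; apply: PB.
Qed.

Lemma preim_ideal (K : fieldType) (g h : lieAlgType K) (f : {lie g -> h})
    (I : h -> Prop) : is_lie_ideal I -> is_lie_ideal (fun u => I (f u)).
Proof.
case=> I0 Ilin Ibr; split=> [|a u w Iu Iw|u w Iw].
- by rewrite raddf0.
- by rewrite linearP; apply: Ilin.
- by rewrite lie_morphB; apply: Ibr.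
Qed.

(** The hypotheses say that [(p, q, v)] is a Lie homomorphism to the quotient of
    [heis] by its coordinate [z]. The bound comes from lifting this
    homomorphism to [heis] along a finite presentation of [L]: the relators, and
    with them the whole ideal of relations, land in a single [heis_bounded m]. *)
Lemma fp_cocycle_bounded (K : fieldType) (L : lieAlgType K)
    (p q v : {linear L -> {poly K}}) :
  (forall l l', p [lie l, l'] = v l * p l' - v l' * p l) ->
  (forall l l', q [lie l, l'] = v l' * q l - v l * q l') ->
  (forall l l', v [lie l, l'] = 0) ->
  finitely_presented L ->
  exists m, forall l l', [lie l, l'] = 0 ->
    (size (p l * q l' - p l' * q l)%R <= m)%N.
Proof.
move=> pB qB vB [n [R [iso [iso' isoK isoK']]]].
pose pr u : L := iso (quot_proj (fun r => r \in R) u).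
pose h := free_lift (fun i : 'I_n =>
  (p (pr (free_gen K i)), q (pr (free_gen K i)), v (pr (free_gen K i)), 0)
    : heis K).
have prD : {morph pr : u w / u + w} by move=> u w; rewrite /pr !linearD.
have prZ a u : pr (a *: u) = a *: pr u by rewrite /pr !linearZ.
have prB u w : pr [lie u, w] = [lie pr u, pr w] by rewrite /pr !lie_morphB.
have pr0 : pr 0 = 0 by rewrite /pr !linear0.
have hE u : [/\ heis_p (h u) = p (pr u), heis_q (h u) = q (pr u)
                & heis_v (h u) = v (pr u)].
  elim/freeLie_ind: u => [i||u w [pu qu vu] [pw qw vw]|a u [pu qu vu]
      |u w [pu qu vu] [pw qw vw]].
  - by rewrite /h free_lift_gen.
  - by rewrite /h pr0 !linear0.
  - by rewrite /h linearD prD !linearD -/h -pu -qu -vu -pw -qw -vw.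
  - by rewrite /h linearZ prZ !linearZ -/h -pu -qu -vu.
  - by rewrite /h lie_morphB prB pB qB vB -/h -pu -qu -vu -pw -qw -vw.
exists (\max_(r <- R) size (heis_z (h r))) => l l' ll'.
set m := \max_(r <- R) _.
have [u ul] : exists u, pr u = l.
  by exists (repr (iso' l)); rewrite /pr quot_proj_repr isoK'.
have [w wl'] : exists w, pr w = l'.
  by exists (repr (iso' l')); rewrite /pr quot_proj_repr isoK'.
have uw : gen_ideal (fun r => r \in R) [lie u, w].
  rewrite -[[lie u, w]]subr0; apply/quot_projP; apply: (can_inj isoK).
  by rewrite -/(pr _) -/(pr 0) prB ul wl' ll' pr0.
have [] : heis_bounded m (h [lie u, w]).
  apply: (uw (fun t => heis_bounded m (h t))).
  - exact: (preim_ideal h (heis_bounded_ideal K m)).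
  - move=> r rR; have [pr_ qr vr] := hE r.
    have r0 : pr r = 0.
      rewrite /pr (_ : quot_proj _ r = 0) ?linear0 //.
      rewrite -(linear0 (quot_proj (fun r => r \in R))).
      by apply/quot_projP; rewrite subr0; apply: gen_ideal_sub.
    split; rewrite ?pr_ ?qr ?vr ?r0 ?linear0 //.
    by rewrite /m (big_rem r) //= leq_maxl.
have [pu qu _] := hE u; have [pw qw _] := hE w.
move=> _ _ _; rewrite /h lie_morphB /heis_z /= -/h.
by rewrite pu qu pw qw ul wl'.
Qed.

(** * The weak commutativity construction *)

Section NullMorphism.
Variables (K : fieldType) (g h : lieAlgType K).

Lemma null_morphB : {morph (\0 : g -> h) : x y / [lie x, y]}.
Proof. by move=> x y; rewrite /= lie_0l. Qed.
HB.instance Definition _ := isLieMorphism.Build K g h \0 null_morphB.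

End NullMorphism.

Lemma chi_universal (K : fieldType) (g h : lieAlgType K)
    (f1 f2 : {lie g -> h}) :
  (forall x, [lie f1 x, f2 x] = 0) ->
  exists phi : {lie chi g -> h},
    (forall x, phi (chi_inl x) = f1 x) /\ (forall x, phi (chi_inr x) = f2 x).
Proof.
move=> f12.
have rel r : chi_rel r -> fprod_lift f1 f2 r = 0.
  by case=> x; rewrite lie_morphB /= fprod_lift_inl fprod_lift_inr.
exists (quot_lift (f := fprod_lift f1 f2) rel).
by split=> x; rewrite [LHS]quot_lift_proj /= (fprod_lift_inl, fprod_lift_inr).
Qed.

Lemma chi_ind (K : fieldType) (g : lieAlgType K) (P : chi g -> Prop) :
  (forall x, P (chi_inl x)) -> (forall x, P (chi_inr x)) -> P 0 ->
  (forall u w, P u -> P w -> P (u + w)) ->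
  (forall a u, P u -> P (a *: u)) ->
  (forall u w, P u -> P w -> P [lie u, w]) -> forall u, P u.
Proof.
move=> Pl Pr P0 PD PZ PB u.
rewrite -[u]quot_proj_repr -[repr u]quot_proj_repr; move: (repr (repr u)).
elim/freeLie_ind=> [[x|x]||s t|a s|s t].
- exact: Pl.
- exact: Pr.
- by rewrite !linear0.
- by rewrite !linearD; exact: PD.
- by rewrite !linearZ; exact: PZ.
- by rewrite !lie_morphB; exact: PB.
Qed.

Section Delta.
Variables (K : fieldType) (g : lieAlgType K).
Local Notation l := (@chi_inl K g).
Local Notation r := (@chi_inr K g).

Lemma chi_inl_linear : linear l.
Proof. by move=> a x y; rewrite /chi_inl !linearP. Qed.
HB.instance Definition _ :=
  GRing.isLinear.Build K g (chi g) *:%R l chi_inl_linear.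

Lemma chi_inr_linear : linear r.
Proof. by move=> a x y; rewrite /chi_inr !linearP. Qed.
HB.instance Definition _ :=
  GRing.isLinear.Build K g (chi g) *:%R r chi_inr_linear.

Lemma chi_inlB : {morph l : x y / [lie x, y]}.
Proof. by move=> x y; rewrite /chi_inl !lie_morphB. Qed.
Lemma chi_inrB : {morph r : x y / [lie x, y]}.
Proof. by move=> x y; rewrite /chi_inr !lie_morphB. Qed.

Lemma chi_commute x : [lie l x, r x] = 0.
Proof.
have : quot_proj (@chi_rel K g) [lie fprod_inl g x, fprod_inr g x]
    = quot_proj (@chi_rel K g) 0.
  by apply/quot_projP; rewrite subr0; apply: gen_ideal_sub.
by rewrite linear0 lie_morphB.
Qed.

(** Polarisation of [[x, x'] = 0]. *)
Lemma chi_cross x y : [lie l x, r y] = [lie r x, l y].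
Proof.
have := chi_commute (x + y).
rewrite !linearD lie_addl !lie_addr !chi_commute add0r addr0 => /eqP.
by rewrite addr_eq0 => /eqP->; rewrite -lie_anti.
Qed.

Definition chi_delta x : chi g := l x - r x.
Lemma chi_delta_linear : linear chi_delta.
Proof.
move=> a x y; rewrite /chi_delta [l _]linearP [r _]linearP /=.
by rewrite scalerBr opprD addrACA.
Qed.
HB.instance Definition _ :=
  GRing.isLinear.Build K g (chi g) *:%R chi_delta chi_delta_linear.

Lemma chi_alpha_delta x : chi_alpha (chi_delta x) = 0.
Proof. by rewrite linearB /= chi_alpha_inl chi_alpha_inr subrr. Qed.

Hypothesis charK : 2%N \notin [pchar K].

(** The trilinear map [T x y z = [d x, [y, z']]] is antisymmetric in [y, z] by
    [chi_cross], and symmetric in [x, y] because [[[x, y], z']] can be expanded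
    by the Leibniz rule before or after moving the prime. Such a map is its own
    opposite. *)
Lemma delta_cross x y z : [lie chi_delta x, [lie l y, r z]] = 0.
Proof.
pose T x y z := [lie chi_delta x, [lie l y, r z]].
have T23 a b c : T a b c = - T a c b.
  by rewrite /T -lie_oppr chi_cross -lie_anti.
have T12 a b c : T a b c = T b a c.
  apply/eqP; rewrite -subr_eq0; apply/eqP.
  rewrite /T !lie_addl !lie_oppl opprD opprK addrACA.
  have -> : [lie l a, [lie l b, r c]] - [lie l b, [lie l a, r c]]
             = [lie l [lie a, b], r c].
    by rewrite (lie_leibniz (l a)) addrK chi_inlB.
  rewrite [X in _ + X]addrC.
  have -> : [lie r b, [lie l a, r c]] - [lie r a, [lie l b, r c]]
             = - [lie r [lie a, b], l c].
    by rewrite !chi_cross (lie_leibniz (r a)) opprD addrCA subrr addr0 chi_inrB.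
  by rewrite -chi_cross subrr.
apply: (double_eq0 charK); rewrite -/(T x y z).
(* Both sides equal [T z x y], the left after four swaps, the right after two. *)
rewrite [in RHS]T23 opprK [in RHS]T12.
by rewrite [in LHS]T12 [in LHS]T23 [in LHS]T12 [in LHS]T23 opprK.
Qed.

(** The mixed part of [[d x, d y] = [x, y] + [x, y]' - 2 [x, y']] commutes with
    [d z] by [delta_cross], and the mixed terms of the rest cancel by
    [chi_cross]. *)
Lemma delta_triple x y z :
  [lie [lie chi_delta x, chi_delta y], chi_delta z]
  = chi_delta [lie [lie x, y], z].
Proof.
have xy : [lie chi_delta x, chi_delta y]
    = l [lie x, y] + r [lie x, y] - [lie l x, r y] - [lie l x, r y].
  rewrite lie_addl !lie_addr !lie_oppl !lie_oppr opprK -chi_cross.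
  by rewrite chi_inlB chi_inrB addrA addrAC; congr (_ - _); rewrite addrAC.
have cz : [lie [lie l x, r y], chi_delta z] = 0.
  by rewrite lie_anti delta_cross oppr0.
rewrite xy !lie_addl !lie_oppl cz !subr0.
rewrite /chi_delta !lie_addr !lie_oppr (chi_cross [lie x, y]).
by rewrite !chi_inlB !chi_inrB addrA addrNK.
Qed.

End Delta.

Section DeltaL.
Variables (K : fieldType) (g : lieAlgType K).

Lemma delta_in_ker (x : g) : chi_delta x \in lie_ker_pred (@chi_alpha K g).
Proof. by rewrite inE; apply/eqP; exact: chi_alpha_delta. Qed.

Definition delta (x : g) : lieL g := LieKer (delta_in_ker x).

Lemma delta_linear : linear delta.
Proof. by move=> a x y; apply: val_inj; rewrite /= linearP. Qed.
HB.instance Definition _ :=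
  GRing.isLinear.Build K g (lieL g) *:%R delta delta_linear.

Lemma delta_is_triple_hom : 2%N \notin [pchar K] -> forall x y z,
  [lie [lie delta x, delta y], delta z] = delta [lie [lie x, y], z].
Proof. by move=> charK x y z; apply: val_inj; exact: delta_triple. Qed.

End DeltaL.

(** * Free Lie algebras *)

Lemma free_lie_subsingleton (K : fieldType) (X : Type) :
  (forall i j : X, i = j) -> lie_abelian (freeLie K X).
Proof.
move=> X1.
pose line (u : freeLie K X) := u = 0 \/ exists k a, u = a *: free_gen K k.
have lineB u w : line u -> line w -> [lie u, w] = 0.
  move=> [->|[i [a ->]]]; first by rewrite lie_0l.
  move=> [->|[j [b ->]]]; first by rewrite lie_0r.
  by rewrite (X1 j i) lie_scalel lie_scaler lie_alternating !scaler0.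
suff lineT u : line u by move=> u w; exact: lineB.
elim/freeLie_ind: u => [k||u w Lu Lw|a u [->|[k [b ->]]]|u w Lu Lw].
- by right; exists k, 1; rewrite scale1r.
- by left.
- case: Lu => [->|[i [a ->]]]; first by rewrite add0r.
  case: Lw => [->|[j [b ->]]]; first by rewrite addr0; right; exists i, a.
  by right; exists i, (a + b); rewrite (X1 j i) scalerDl.
- by left; rewrite scaler0.
- by right; exists k, (a * b); rewrite scalerA.
- by left; exact: lineB.
Qed.

(** A basis of [g] has two distinct members, and a map on the basis may take the
    value [a] at the first and [b] everywhere else. *)
Lemma free_nonabelian_pair (K : fieldType) (g : lieAlgType K) :
  is_free_lie g -> ~ lie_abelian g ->
  exists x y : g, forall (h : lieAlgType K) (a b : h),
    exists rho : {lie g -> h}, rho x = a /\ rho y = b.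
Proof.
move=> [X [f [f' fK f'K]]] nab.
have [i [j ij]] : exists i j : X, i <> j.
  apply: contrapT => X1; apply: nab => x y.
  apply: (can_inj f'K); rewrite -[x]f'K -[y]f'K.
  rewrite -lie_morphB free_lie_subsingleton ?linear0 // => k l.
  by apply: contrapT => kl; apply: X1; exists k, l.
exists (f (free_gen K i)), (f (free_gen K j)) => h a b.
pose s k := if `[< k = i >] then a else b.
have rhoP : linear (free_lift s \o f').
  move=> c u w; rewrite /= -linearP; congr (free_lift s _).
  by apply: (can_inj fK); rewrite f'K linearP /= !f'K.
have rhoB : {morph free_lift s \o f' : u w / [lie u, w]}.
  move=> u w; rewrite /= -lie_morphB; congr (free_lift s _).
  by apply: (can_inj fK); rewrite f'K lie_morphB /= !f'K.
pose rhoL := GRing.isLinear.Build K g h *:%R _ rhoP.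
pose rhoM := isLieMorphism.Build K g h _ rhoB.
pose rho : {lie g -> h} := HB.pack (free_lift s \o f') rhoL rhoM.
exists rho; rewrite /= !fK !free_lift_gen /s; split; case: asboolP => //.
by move=> /esym.
Qed.

(** * The main theorem *)

Theorem proposition3p9 (K : fieldType) (g : lieAlgType K)
    (charK : 2%N \notin [pchar K]%R)
    (g_free : is_free_lie g) (g_nonabelian : ~ lie_abelian g) :
  ~ finitely_presented (lieL g).
Proof.
have [x [y univ]] := free_nonabelian_pair g_free g_nonabelian.
have [rho [rx ry]] := univ (heis K) (0, 0, 'X, 0) (1, 0, 0, 0).
pose nul : {lie g -> heis K} := \0.
have rho0 u : [lie rho u, nul u] = 0 by exact: lie_0r.
have rho0' u : [lie nul u, rho u] = 0 by exact: lie_0l.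
have [phi1 [phi1l phi1r]] := chi_universal rho0.
have [phi2 [phi2l phi2r]] := chi_universal rho0'.
(* The module coordinates of the two copies of [g] are both read off in the
   first coordinate of [heis]; only their roles in the cocycle differ. *)
pose p : {linear lieL g -> {poly K}} := @heis_p K \o phi1 \o val.
pose q : {linear lieL g -> {poly K}} := @heis_p K \o phi2 \o val.
pose v : {linear lieL g -> {poly K}} := @heis_v K \o phi1 \o val.
(* Both sides of [v(phi1) + v(phi2) = v(rho alpha)] are additive and vanish on
   brackets, so it is enough to compare them on the generators of [chi g]. *)
have v2 (l : lieL g) : heis_v (phi2 (val l)) = - v l.
  apply/eqP; rewrite -addr_eq0 addrC; apply/eqP; rewrite /v /=.
  have := valP l; rewrite inE; move/eqP.
  have <- : heis_v (rho (chi_alpha (val l))) =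
      heis_v (phi1 (val l)) + heis_v (phi2 (val l)).
    elim/chi_ind: (val l) => [u|u||c c' Hc Hc'|a c Hc|c c' _ _].
    - by rewrite phi1l phi2l chi_alpha_inl /= linear0 addr0.
    - by rewrite phi1r phi2r chi_alpha_inr /= linear0 add0r.
    - by rewrite !linear0 addr0.
    - by rewrite !linearD /= Hc Hc' addrACA.
    - by rewrite !linearZ /= Hc scalerDr.
    - by rewrite !lie_morphB !heis_bracketE addr0.
  by move=> ->; rewrite !linear0.
move=> /(fp_cocycle_bounded (p := p) (q := q) (v := v)) [l l'|l l'|l l'|m].
- by rewrite /p /v /= lie_morphB heis_bracketE.
- by rewrite /q /= lie_morphB heis_bracketE !v2 !mulNr opprK addrC.
- by rewrite /v /= lie_morphB heis_bracketE.
have phi1d u : phi1 (chi_delta u) = rho u.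
  by rewrite linearB /= phi1l phi1r subr0.
have phi2d u : phi2 (chi_delta u) = - rho u.
  by rewrite linearB /= phi2l phi2r sub0r.
pose yk k := iter k (lie_bracket x) y.
have ykE k : heis_p (rho (yk k)) = 'X^k /\ heis_v (rho (yk k)) = 0.
  elim: k => [|k [IHp IHv]]; first by rewrite /yk /= ry expr0.
  rewrite /yk /= -/(yk k) lie_morphB !heis_bracketE IHp IHv rx mul0r subr0.
  by rewrite exprS.
pose n' : lieL g := [lie delta x, delta y] + delta [lie x, y].
pose n : lieL g := [lie delta x, delta (yk m)] - delta (yk m.+1).
have n'n : [lie n', n] = 0.
  exact: (commuting_elements (delta_is_triple_hom charK) x y charK m).
move=> /(_ n' n n'n).
have n'E : val n' = [lie chi_delta x, chi_delta y] + chi_delta [lie x, y].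
  by [].
have nE : val n = [lie chi_delta x, chi_delta (yk m)] - chi_delta (yk m.+1).
  by [].
have pn' : p n' = 'X + 'X.
  rewrite -[LHS]/(heis_p (phi1 (val n'))) n'E linearD /= lie_morphB !phi1d.
  by rewrite -lie_morphB linearD /= (ykE 1).1.
have qn' : q n' = 0.
  rewrite -[LHS]/(heis_p (phi2 (val n'))) n'E linearD /= lie_morphB !phi2d.
  by rewrite lie_oppl lie_oppr opprK -lie_morphB subrr linear0.
have qn : q n = 'X^(m.+1) + 'X^(m.+1).
  rewrite -[LHS]/(heis_p (phi2 (val n))) nE linearB /= lie_morphB !phi2d.
  rewrite lie_oppl lie_oppr !opprK.
  by rewrite -lie_morphB linearD /= (ykE m.+1).1.
have two0 : (2%:R : K) != 0 by move: charK; rewrite inE.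
rewrite qn' mulr0 subr0 pn' qn -!mulr2n mulrnAl mulrnAr -exprS -mulrnA.
rewrite -scaler_nat size_scale ?size_polyXn.
  by move=> /leq_trans /(_ (leqW (leqnSn m))); rewrite ltnn.
by rewrite natrM; apply: mulf_neq0.
Qed.
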